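(* There is a constant $C_n>0$ depending only on $n$ such that the following holds. Let $\mathcal{D}$ be a dyadic grid in $\mathbf{R}^d$ and let $\mathcal{F}\subseteq\mathcal{D}$ be finite. For each $F\in L^0(\mathbf{R}^d;\mathcal{K})$ satisfying $F\mathbf{1}_Q\in L^1(\mathbf{R}^d;\mathcal{K})$ for all cubes $Q$, there is a sparse collection $\mathcal{S}\subseteq\mathcal{F}$ for which $$M^{\mathcal{K}}_{\mathcal{F}}F(x)\subseteq C_n M^{\mathcal{K}}_{\mathcal{S}}F(x)$$ for a.e. $x\in\mathbf{R}^d$.
   Context: $d,n\ge 1$ are fixed integers, $\mathbf{F}$ is $\mathbf{R}$ or $\mathbf{C}$. $L^0(\mathbf{R}^d;\mathbf{F}^n)$ is the space of measurable functions $\mathbf{R}^d\to\mathbf{F}^n$ (modulo a.e. equality; Lebesgue measure). A cube is a cube in $\mathbf{R}^d$ with sides parallel to the coordinate axes. $\mathcal{K}$ is the collection of non-empty closed convex $K\subseteq\mathbf{F}^n$ that are symmetric: $\lambda u\in K$ for $u\in K$, $\lambda\in\mathbf{F}$, $|\lambda|=1$. For $c>0$, $cK=\{cu:u\in K\}$. $L^0(\mathbf{R}^d;\mathcal{K})$ is the set of $F:\mathbf{R}^d\to\mathcal{K}$ such that $\{x:F(x)\cap E\ne\emptyset\}$ is measurable for every measurable (equivalently, every open) $E\subseteq\mathbf{F}^n$. $S^0(\mathbf{R}^d;F)$ is the set of $f\in L^0(\mathbf{R}^d;\mathbf{F}^n)$ with $f(x)\in F(x)$ a.e. $L^1(\mathbf{R}^d;\mathcal{K})$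 is the set of $F\in L^0(\mathbf{R}^d;\mathcal{K})$ for which $S^0(\mathbf{R}^d;F)$ is a bounded subset of $L^1(\mathbf{R}^d;\mathbf{F}^n)$. $F\mathbf{1}_Q$ equals $F$ on $Q$ and $\{0\}$ off $Q$. For $F\mathbf{1}_Q\in L^1(\mathbf{R}^d;\mathcal{K})$, $\langle F\rangle_Q:=\{\frac1{|Q|}\int_Qf\,dx:f\in S^0(\mathbf{R}^d;F\mathbf{1}_Q)\}$. For a collection of cubes $\mathcal{P}$, $M^{\mathcal{K}}_{\mathcal{P}}F(x)$ is the smallest set in $\mathcal{K}$ containing $\bigcup_{Q\in\mathcal{P}}\langle F\rangle_Q\mathbf{1}_Q(x)$ (where $\langle F\rangle_Q\mathbf{1}_Q(x)$ is $\langle F\rangle_Q$ if $x\in Q$ and $\{0\}$ otherwise). A dyadic grid is a collection of half-open cubes $\mathcal{D}=\bigcup_{k\in\mathbf{Z}}\mathcal{D}_k$ such that each $\mathcal{D}_k$ partitions $\mathbf{R}^d$ into cubes of side length $2^k$ and each cube in $\mathcal{D}_k$ is a union of $2^d$ cubes of $\mathcal{D}_{k-1}$. A collection of cubes $\mathcal{S}$ is sparse if for all $Q\in\mathcal{S}$, $\big|\bigcup_{Q'\in\mathcal{S},\,Q'\subsetneq Q}Q'\big|\le\frac12|Q|$. *)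

(* Defs.v *)
From HB Require Import structures.
From mathcomp Require Import all_boot all_order all_algebra.
From mathcomp Require Import complex.
From mathcomp Require Import all_classical all_reals all_analysis.

Set Implicit Arguments.
Unset Strict Implicit.
Unset Printing Implicit Defensive.

Import Order.TTheory GRing.Theory Num.Theory.
Import numFieldNormedType.Exports.

Local Open Scope classical_set_scope.
Local Open Scope ring_scope.

Section cons_measure.
Context {R : realType} {d : nat}.
Notation mR := (measurableTypeR R).

Definition cons_point (p : mR * d.-tuple mR) : d.+1.-tuple mR :=
  [tuple of p.1 :: p.2].

Lemma measurable_cons_point : measurable_fun setT cons_point.
Proof. by apply: measurable_cons. Qed.

Variable m : {sigma_finite_measure set (d.-tuple mR) -> \bar R}.

Definition cons_measure : set (d.+1.-tuple mR) -> \bar R :=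
  pushforward (@lebesgue_measure R \x m)%E cons_point.

HB.instance Definition _ := Measure.copy cons_measure
  (measure_function_pushforward__canonical__measure_function_Measure
     (@lebesgue_measure R \x m)%E measurable_cons_point).

Lemma cons_measure_sigma_finite : sigma_finite setT cons_measure.
Proof.
have /sigma_finiteP[F [TF ndF Foo]] := sigma_finiteT (@lebesgue_measure R).
have /sigma_finiteP[G [TG ndG Goo]] := sigma_finiteT m.
pose head_in k : set (d.+1.-tuple mR) := (@tnth _ _ ^~ ord0) @^-1` F k.
pose tail_in k : set (d.+1.-tuple mR) :=
  (fun t : d.+1.-tuple mR => [tuple of behead t] : d.-tuple mR) @^-1` G k.
exists (fun k => head_in k `&` tail_in k).
  apply/seteqP; split => // t _.
  have [i _ Fi] : (\bigcup_i F i) (tnth t ord0) by rewrite -TF.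
  have [j _ Gj] : (\bigcup_i G i) [tuple of behead t] by rewrite -TG.
  exists (maxn i j) => //; split.
  - by have /subsetPset := ndF _ _ (leq_maxl i j); exact.
  - by have /subsetPset := ndG _ _ (leq_maxr i j); exact.
move=> k; have [mF Fk] := Foo k; have [mG Gk] := Goo k; split.
  apply: measurableI; rewrite -[X in measurable X]setTI.
  - exact: measurable_tnth.
  - exact: measurable_behead.
rewrite /cons_measure /pushforward (_ : _ @^-1` _ = F k `*` G k).
  by rewrite product_measure1E// lte_mul_pinfty// ge0_fin_numE.
have consK (p : (mR * d.-tuple mR)%type) :
    [tuple of behead (cons_point p)] = p.2 by exact/val_inj.
by apply/seteqP; split => p [/= Fp Gp]; split => //;
  move: Gp; rewrite /tail_in /= consK.
Qed.

HB.instance Definition _ :=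
  Measure_isSigmaFinite.Build _ _ _ cons_measure cons_measure_sigma_finite.

End cons_measure.

(* Lebesgue measure on the Borel sets of R^d, as a d-fold product. *)
Fixpoint borel_lebesgue (R : realType) (d : nat) :
    {sigma_finite_measure set (d.-tuple (measurableTypeR R)) -> \bar R} :=
  match d with
  | 0 => dirac [tuple]
  | d'.+1 => cons_measure (borel_lebesgue R d')
  end.

(* R^d with the sigma-algebra of Lebesgue measurable sets, i.e. of the sets that
   are Caratheodory measurable for Lebesgue outer measure; [lebesgue] is
   therefore complete. *)
Definition euclidean (R : realType) (d : nat) :=
  caratheodory_type (mu_ext (borel_lebesgue R d)).

HB.instance Definition _ R d := Measurable.on (euclidean R d).

Definition lebesgue (R : realType) (d : nat) :
    {measure set (euclidean R d) -> \bar R} :=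
  @completed_measure_extension _ _ R (borel_lebesgue R d).

Definition box (R : realType) (d : nat) (bl br : bool) (a : d.-tuple R) (l : R) :
    set (euclidean R d) :=
  [set x | forall i : 'I_d,
    tnth x i \in Interval (BSide bl (tnth a i)) (BSide br (tnth a i + l))].

(* [bl] and [br] tell on which sides the cube contains its faces, so open, closed
   and both kinds of half-open cubes are covered. *)
Definition cube (R : realType) (d : nat) (Q : set (euclidean R d)) : Prop :=
  exists bl br (a : d.-tuple R) (l : R), 0 < l /\ Q = box bl br a l.

(* Either all [a_i, a_i + l[ or all ]a_i, a_i + l]. *)
Definition half_open_cube (R : realType) (d : nat) (l : R)
    (Q : set (euclidean R d)) : Prop :=
  exists b (a : d.-tuple R), Q = box b b a l.

Definition dyadic_grid (R : realType) (d : nat)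
    (D : set (set (euclidean R d))) : Prop :=
  exists2 G : int -> set (set (euclidean R d)),
    D = \bigcup_k G k &
    forall k : int,
      [/\ partition (G k) id [set: euclidean R d],
          forall Q, G k Q -> half_open_cube (2 ^ k) Q &
          forall Q, G k Q -> exists P : set (set (euclidean R d)),
            [/\ P `<=` G (k - 1), (P #= `I_(2 ^ d))%card &
                Q = \bigcup_(Q' in P) Q']].

Definition sparse (R : realType) (d : nat)
    (S : set (set (euclidean R d))) : Prop :=
  forall Q, S Q ->
    (lebesgue R d (\bigcup_(Q' in [set Q' | S Q' /\ Q' `<` Q]) Q') <=
       2^-1%:E * lebesgue R d Q)%E.

Variant scalar_kind := RealScalars | ComplexScalars.

Definition scalar_field (R : realType) (s : scalar_kind) : numFieldType :=
  match s with
  | RealScalars => R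
  | ComplexScalars => R[i]
  end.

Definition scalar_re (R : realType) s : scalar_field R s -> R :=
  match s with
  | RealScalars => fun z => z
  | ComplexScalars => fun z => complex.Re z
  end.

Definition scalar_im (R : realType) s : scalar_field R s -> R :=
  match s with
  | RealScalars => fun=> 0
  | ComplexScalars => fun z => complex.Im z
  end.

(* [y] is ignored over the reals. *)
Definition mk_scalar (R : realType) s (x y : R) : scalar_field R s :=
  match s with
  | RealScalars => x
  | ComplexScalars => Complex x y
  end.

Definition of_real (R : realType) s (x : R) : scalar_field R s := mk_scalar s x 0.

Section convex_body_valued.
Context {R : realType} {s : scalar_kind} {d n : nat}.

Local Notation F := (scalar_field R s).
Local Notation X := (euclidean R d).
Local Notation V := 'rV[F]_n.
Local Notation mu := (lebesgue R d).
Implicit Types (f : X -> V) (A : X -> set V) (Q : set X).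

Definition borel_vector := g_sigma_algebraType (@open V).

Definition enorm (u : V) : R :=
  Num.sqrt (\sum_j (scalar_re (u 0 j) ^+ 2 + scalar_im (u 0 j) ^+ 2)).

Definition integral_vector Q f : V :=
  \row_j mk_scalar s (\int[mu]_(x in Q) scalar_re (f x 0 j))
                     (\int[mu]_(x in Q) scalar_im (f x 0 j)).

(* Convexity is over the scalar field F; in the order of R[i] the coefficients
   t with 0 <= t <= 1 are exactly the real ones. *)
Definition convex_bodies : set (set V) :=
  [set K : set V | [/\ K !=set0, closed K,
     convex_set (K : set (convex_lmodType V)) &
     forall (u : V) (z : F), K u -> `|z| = 1 -> K (z *: u)]].

Definition dilate (c : R) (K : set V) : set V :=
  [set of_real s c *: u | u in K].

Definition L0_bodies A : Prop :=
  (forall x, convex_bodies (A x)) /\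
  (forall E : set borel_vector, measurable E ->
     measurable [set x : X | A x `&` E !=set0]).

Definition selections A : set (X -> V) :=
  [set f | measurable_fun [set: X] (f : X -> borel_vector) /\
           {ae mu, forall x, A x (f x)}].

Definition L1_bodies A : Prop :=
  L0_bodies A /\
  exists B : R, forall f, selections A f ->
    (\int[mu]_x (enorm (f x))%:E <= B%:E)%E.

Definition cutoff Q A : X -> set V := patch (fun=> [set 0]) Q A.

Definition average A Q : set V :=
  [set of_real s (fine (mu Q))^-1 *: integral_vector Q f
     | f in selections (cutoff Q A)].

Definition maximal (P : set (set X)) A (x : X) : set V :=
  smallest convex_bodies (\bigcup_(Q in P) cutoff Q (fun=> average A Q) x).

End convex_body_valued.

(* Main.v *)
Require Import Defs.
From mathcomp Require Import all_boot all_order all_algebra.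
From mathcomp Require Import all_classical all_reals all_analysis.
From mathcomp Require Import perm measurable_realfun complex ring lra zify.

Import Order.TTheory GRing.Theory Num.Theory.
Import numFieldNormedType.Exports.

Local Open Scope classical_set_scope.
Local Open Scope ring_scope.

(** The stopping rule compares, for a cube Q0, the averages over its subcubes with
    K(Q0), the smallest convex body containing the average over Q0. A subcube is
    bad when its average is not inside C K(Q0). Everything rests on the bad
    subcubes covering at most half of Q0 ([stopping_family]). Given this, a sparse
    family arises by induction on the finite family: keep an inclusion-maximal
    cube Q0, discard the subcubes that are not bad, since Q0 dominates them, and
    recurse on the remaining cubes ([sparse_domination]). Every discarded cube
    lies in a selected cube with a comparable average, so the inclusion between
    the two maximal operators holds at every point.

    The measure estimate reduces the set-valued average to finitely many scalar
    functionals. Seen in R^(2n) through real and imaginary parts, the average over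
    Q0 is a bounded set. Choosing m <= 2n of its points with almost maximal
    determinant gives coordinates with two properties
    ([approximate_auerbach_basis]): they are at most 2 on the average over Q0, and
    a vector of its span all of whose coordinates are at most c lies in m c K(Q0).
    The average over a subcube lies in that span, because a selection over the
    subcube extends by zero to a selection over Q0. Hence a bad subcube has a
    point at which some signed coordinate phi exceeds c.

    For a fixed phi the weak-type bound needs no maximal function
    ([weak_type_estimate]): the selections attaining phi > c on the bad cubes are glued,
    over the maximal ones among these nested cubes, to a single selection on their
    union U ([glued_selection]). Its extension by zero contributes a point v of the
    average over Q0 with c |U| / |Q0| <= phi v <= 2. Summing |U| <= (2 / c) |Q0|
    over the 2m <= 4n signed coordinates gives |Q0| / 2 when c = 16 n, and
    C = 2n c = 32 n^2. *)

(** * Almost extremal bases of bounded sets *)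

Lemma normr_det_le (R : realDomainType) (m : nat) (M : R) (T : 'M[R]_m) :
  (forall i j, `|T i j| <= M) -> `|\det T| <= M ^+ m *+ #|{: 'S_m}|.
Proof.
move=> hT; apply: le_trans (ler_norm_sum _ _ _) _.
rewrite -sumr_const; apply: ler_sum => s _.
rewrite normrM normrX normrN1 expr1n mul1r normr_prod.
apply: (@le_trans _ _ (\prod_(i < m) M)); last by rewrite prodr_const card_ord.
by apply: ler_prod => i _; rewrite normr_ge0 hT.
Qed.

(** An Auerbach basis of a bounded set: among m points of A with m maximal for
    linear independence, choose those whose determinant is at least half the
    supremum. By Cramer's rule a coordinate of u is the ratio of the determinant
    with one point replaced by u to the chosen determinant, hence at most 2.
    Settling for half the supremum avoids any closedness assumption on A. *)
Lemma approximate_auerbach_basis (R : realType) (N : nat) (A : set 'rV[R]_N)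
    (B : R) : (forall u, A u -> forall j, `|u 0 j| <= B) ->
  exists m (W : 'M[R]_(m, N)) (L : 'M[R]_(N, m)),
    [/\ (m <= N)%N, forall i, A (row i W),
        forall u, A u -> u = u *m L *m W &
        forall u i, A u -> `|(u *m L) 0 i| <= 2].
Proof.
move=> AB.
pose P m := `[< exists2 W : 'M[R]_(m, N), forall i, A (row i W) & row_free W >].
have exP : exists m, P m.
  by exists 0; apply/asboolP; exists 0; [case|rewrite /row_free mxrank0].
have leP m : P m -> (m <= N)%N.
  by move=> /asboolP[W _ /eqP <-]; rewrite rank_leq_col.
have [m /asboolP[U0 AU0 freeU0] maxm] := ex_maxnP exP leP.
have spanA u : A u -> (u <= U0)%MS.
  move=> Au; apply/negPn/negP => nuU0.
  suff /maxm : P (m + 1)%N by rewrite addn1 ltnn.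
  apply/asboolP; exists (col_mx U0 u) => [i|].
    case: (split_ordP i) => k ->; first by rewrite rowKu.
    by rewrite rowKd row_id.
  rewrite /row_free eqn_leq rank_leq_row /=.
  rewrite [leqLHS]addn1 -[X in (X < _)%N](eqP freeU0).
  apply: rank_ltmx; rewrite ltmxE col_mx_sub (negPf nuU0) andbF.
  by rewrite -addsmxE addsmxSl.
(* Q computes coordinates with respect to the independent rows of U0. *)
have [Q [U0Q QK]] : exists Q : 'M[R]_(N, m),
    U0 *m Q = 1%:M /\ forall u, A u -> u *m Q *m U0 = u.
  exists (pinvmx U0); split; first exact: mulmxVp.
  by move=> u Au; rewrite mulmxKpV// spanA.
pose dets : set R := [set `|\det (W *m Q)| |
  W in [set W : 'M[R]_(m, N) | forall i, A (row i W)]].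
have dets1 : dets 1 by exists U0 => //; rewrite U0Q det1 normr1.
have supP : has_sup dets.
  split; first by exists 1.
  exists ((\sum_i \sum_j B * `|Q i j|) ^+ m *+ #|{: 'S_m}|) => _ [W AW <-].
  apply: normr_det_le => i j; rewrite mxE.
  have B0 (k : 'I_N) : 0 <= B.
    exact: le_trans (normr_ge0 _) (AB _ (AW i) k).
  apply: le_trans (ler_norm_sum _ _ _) _; apply: ler_sum => k _.
  rewrite normrM (bigD1 j)//= -[leLHS]addr0 lerD//.
    rewrite ler_wpM2r//; have := AB _ (AW i) k.
    by rewrite mxE.
  by apply: sumr_ge0 => l _; rewrite mulr_ge0 ?(B0 k).
have sup1 : 1 <= sup dets by apply: ub_le_sup => //; case: supP.
have [_ [W AW <-] ltW] : exists2 e, dets e & sup dets - sup dets / 2 < e.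
  by apply: sup_adherent => //; rewrite divr_gt0// (lt_le_trans ltr01).
have [T TE] : exists T, T = W *m Q by exists (W *m Q).
rewrite -TE in ltW.
have detT : 0 < `|\det T| by lra.
have uT : T \in unitmx by rewrite unitmxE unitfE -normr_gt0.
have WE : W = T *m U0.
  by apply/row_matrixP => i; rewrite TE -mulmxA row_mul mulmxA QK.
exists m, W, (Q *m invmx T); split => //.
- exact: leP (asboolT (ex_intro2 _ _ U0 AU0 freeU0)).
- move=> u Au; transitivity (u *m (Q *m invmx T) *m (T *m U0)).
    by rewrite !mulmxA mulmxKV// QK.
  by rewrite -WE.
move=> u i Au.
pose W' := \matrix_(k < m) if k == i then u else row k W.
have AW' k : A (row k W') by rewrite rowK; case: ifP.
(* Cramer's rule, from the expansion along row i of W' *m Q. *)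
have detT' : \det (W' *m Q) = \det T * (u *m (Q *m invmx T)) 0 i.
  rewrite (expand_det_row _ i) /invmx uT -!scalemxAr mxE mulrA mulfV ?mul1r//.
    rewrite mulmxA mxE; apply: eq_bigr => j _; congr (_ * _).
      by rewrite !mxE; apply: eq_bigr => k _; rewrite !mxE eqxx.
    rewrite TE !mxE /cofactor; congr (_ * \det _); apply/matrixP => k l.
    rewrite !mxE; apply: eq_bigr => h _; rewrite !mxE eq_sym.
    by rewrite (negPf (neq_lift _ _)) mxE.
  by rewrite -normr_gt0.
have : `|\det (W' *m Q)| <= sup dets.
  by apply: ub_le_sup; [case: supP|exists W'].
rewrite detT' normrM => h.
rewrite -(ler_pM2l detT) (le_trans h)//; lra.
Qed.

(** * Real coordinates and convex bodies *)

Section scalars.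
Context {R : realType} {s : scalar_kind}.
Local Notation F := (scalar_field R s).
Implicit Types (z w : F) (a b : R).

Lemma scalar_reD z w : scalar_re (z + w) = scalar_re z + scalar_re w.
Proof. by case: s z w => // -[a b] [c e]. Qed.

Lemma scalar_imD z w : scalar_im (z + w) = scalar_im z + scalar_im w.
Proof. by case: s z w => [z w|[a b] [c e]] //=; rewrite addr0. Qed.

Lemma scalar_re_scale a z : scalar_re (of_real s a * z) = a * scalar_re z.
Proof. by case: s z => // -[b c] /=; rewrite mul0r subr0. Qed.

Lemma scalar_im_scale a z : scalar_im (of_real s a * z) = a * scalar_im z.
Proof. by case: s z => [z|[b c]] /=; rewrite ?mulr0// mul0r addr0. Qed.

Lemma scalar_ext z w :
  scalar_re z = scalar_re w -> scalar_im z = scalar_im w -> z = w.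
Proof. by case: s z w => // -[a b] [c e] /= -> ->. Qed.

Lemma scalar_re_mk a b : scalar_re (mk_scalar s a b) = a.
Proof. by case: s. Qed.

Lemma scalar_im_mk a b : (s = RealScalars -> b = 0) ->
  scalar_im (mk_scalar s a b) = b.
Proof. by case: s => // /(_ erefl) ->. Qed.

Lemma scalar_im_real z : s = RealScalars -> scalar_im z = 0.
Proof. by case: s z. Qed.

Lemma of_realD a b : of_real s (a + b) = of_real s a + of_real s b.
Proof. by rewrite /of_real; case: s => //=; congr Complex; rewrite addr0. Qed.

Lemma of_realN a : of_real s (- a) = - of_real s a.
Proof. by rewrite /of_real; case: s => //=; congr Complex; rewrite oppr0. Qed.

Lemma of_realM a b : of_real s (a * b) = of_real s a * of_real s b.
Proof.
by rewrite /of_real; case: s => //=; congr Complex; rewrite ?mulr0 ?mul0r ?subr0 ?addr0.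
Qed.

Lemma of_real0 : of_real s 0 = 0 :> F.
Proof. by rewrite /of_real; case: s. Qed.

Lemma of_real1 : of_real s 1 = 1 :> F.
Proof. by rewrite /of_real; case: s. Qed.

Lemma of_real_ge0 a : 0 <= a -> 0 <= of_real s a :> F.
Proof. by rewrite /of_real; case: s => //= a0; rewrite lecE /= eqxx. Qed.

Lemma of_real_gt0 a : 0 < a -> 0 < of_real s a :> F.
Proof. by rewrite /of_real; case: s => //= a0; rewrite ltcE /= eqxx. Qed.

Lemma normr_scalar_re_lt z a : `|z| < of_real s a -> `|scalar_re z| < a.
Proof.
rewrite /of_real; case: s z => //= -[x y] /=; rewrite normc_def /= ltcE /= eqxx /=.
move=> h; apply: le_lt_trans h; rewrite -sqrtr_sqr ler_sqrt ?lerDl ?sqr_ge0//.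
by rewrite addr_ge0 ?sqr_ge0.
Qed.

Lemma normr_scalar_im_lt z a : 0 < a -> `|z| < of_real s a -> `|scalar_im z| < a.
Proof.
rewrite /of_real; case: s z => [z|[x y]] /=; first by rewrite normr0.
rewrite normc_def /= ltcE /= eqxx /=.
move=> _ h; apply: le_lt_trans h; rewrite -sqrtr_sqr ler_sqrt ?lerDr ?sqr_ge0//.
by rewrite addr_ge0 ?sqr_ge0.
Qed.

End scalars.

Section realification.
Context {R : realType} {s : scalar_kind} {n : nat}.
Local Notation F := (scalar_field R s).
Local Notation V := 'rV[F]_n.
Implicit Types (u v w : V) (K : set V) (a b c : R).

(** Real and imaginary parts put both kinds of scalars into R^(2n), where the
    determinant argument takes place; for real scalars the second half of the
    coordinates vanishes. *)
Definition realify u : 'rV[R]_(n + n) :=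
  row_mx (\row_j scalar_re (u 0 j)) (\row_j scalar_im (u 0 j)).

Lemma realifyD u v : realify (u + v) = realify u + realify v.
Proof.
by rewrite /realify add_row_mx; congr row_mx; apply/rowP => j;
  rewrite !mxE ?scalar_reD ?scalar_imD.
Qed.

Lemma realifyZ a u : realify (of_real s a *: u) = a *: realify u.
Proof.
by rewrite /realify scale_row_mx; congr row_mx; apply/rowP => j;
  rewrite !mxE ?scalar_re_scale ?scalar_im_scale.
Qed.

Lemma realify0 : realify 0 = 0.
Proof. by rewrite -(scale0r (0 : V)) -of_real0 realifyZ scale0r. Qed.

Lemma realify_inj : injective realify.
Proof.
move=> u v /eq_row_mx[/rowP hre /rowP him]; apply/rowP => j.
by apply: scalar_ext; [have := hre j|have := him j]; rewrite !mxE.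
Qed.

Lemma realify_lincomb m (l : 'I_m -> R) (w : 'I_m -> V) :
  realify (\sum_i of_real s (l i) *: w i) = \sum_i l i *: realify (w i).
Proof.
rewrite (big_morph _ realifyD realify0).
by apply: eq_bigr => i _; rewrite realifyZ.
Qed.

Lemma normr_realify_le_enorm u k : `|realify u 0 k| <= enorm u.
Proof.
have aux j : scalar_re (u 0 j) ^+ 2 + scalar_im (u 0 j) ^+ 2 <= enorm u ^+ 2.
  rewrite sqr_sqrtr; last by apply: sumr_ge0 => i _; rewrite addr_ge0 ?sqr_ge0.
  rewrite (bigD1 j)//= lerDl.
  by apply: sumr_ge0 => i _; rewrite addr_ge0 ?sqr_ge0.
rewrite -ler_sqr ?nnegrE ?sqrtr_ge0// real_normK ?num_real//.
case: (split_ordP k) => j ->; rewrite ?row_mxEl ?row_mxEr mxE;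
  apply: le_trans (aux j); rewrite ?lerDl ?lerDr ?sqr_ge0//.
Qed.

Lemma convex_bodies_conv {K x y a b} : convex_bodies K -> K x -> K y ->
  0 <= a -> 0 <= b -> a + b = 1 -> K (of_real s a *: x + of_real s b *: y).
Proof.
move=> [_ _ cK _] Kx Ky a0 b0 ab1.
have a01 : (0 <= of_real s a :> F) && (of_real s a <= 1).
  by rewrite of_real_ge0//= -subr_ge0 -of_real1 -of_realN -of_realD of_real_ge0//; lra.
have : K (of_real s a *: x + (1 - of_real s a) *: y).
  apply: set_mem.
  exact: cK x y (Itv01 (andP a01).1 (andP a01).2) (mem_set Kx) (mem_set Ky).
by rewrite -of_real1 -of_realN -of_realD (_ : 1 - a = b)//; lra.
Qed.

Lemma convex_bodiesN {K x} : convex_bodies K -> K x -> K (- x).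
Proof. by move=> [_ _ _ sK] Kx; rewrite -scaleN1r; apply: sK => //; rewrite normrN1. Qed.

Lemma convex_bodies0 {K} : convex_bodies K -> K 0.
Proof.
move=> bK; have [[x Kx] _ _ _] := bK.
have h : 2^-1 + 2^-1 = 1 :> R by lra.
have := convex_bodies_conv bK Kx (convex_bodiesN bK Kx) _ _ h.
by rewrite scalerN subrr; apply; lra.
Qed.

(** The dilates of a convex body K are the balls of its Minkowski gauge, for which
    this is the triangle inequality. *)
Lemma dilate_add {K x y a b} : convex_bodies K -> 0 <= a -> 0 <= b ->
  dilate a K x -> dilate b K y -> dilate (a + b) K (x + y).
Proof.
move=> bK a0 b0 [x' Kx <-] [y' Ky <-].
have [|ab0] := eqVneq (a + b) 0.
  move=> /eqP; rewrite paddr_eq0// => /andP[/eqP-> /eqP->].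
  exists 0; first exact: convex_bodies0.
  by rewrite addr0 of_real0 !scale0r addr0.
exists (of_real s (a / (a + b)) *: x' + of_real s (b / (a + b)) *: y').
  by apply: convex_bodies_conv => //;
    rewrite ?divr_ge0 ?addr_ge0// -mulrDl divff.
by rewrite scalerDr !scalerA -!of_realM !(mulrC (a + b)) !divfK.
Qed.

Lemma dilate_le {K a b} : convex_bodies K -> 0 <= a -> a <= b ->
  dilate a K `<=` dilate b K.
Proof.
move=> bK a0 ab u Ku; rewrite -(subrKC a b) -(addr0 u).
apply: dilate_add => //; first by rewrite subr_ge0.
by exists 0; [exact: convex_bodies0|rewrite scaler0].
Qed.

Lemma dilate_lincomb {K} m (l : 'I_m -> R) (w : 'I_m -> V) c :
  convex_bodies K -> (forall i, K (w i)) -> \sum_i `|l i| <= c ->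
  dilate c K (\sum_i of_real s (l i) *: w i).
Proof.
move=> bK Kw lc; apply: (dilate_le bK _ lc); first exact: sumr_ge0.
suff [] : 0 <= \sum_i `|l i| /\
  dilate (\sum_i `|l i|) K (\sum_i of_real s (l i) *: w i) by [].
apply: (big_ind2 (fun a u => 0 <= a /\ dilate a K u)).
- by split => //; exists 0; [exact: convex_bodies0|rewrite scaler0].
- move=> a u b v [a0 Ku] [b0 Kv]; split; first exact: addr_ge0.
  exact: dilate_add.
- move=> i _; split => //; have [l0|l0] := ger0P (l i).
    by exists (w i).
  exists (- w i); first exact: convex_bodiesN.
  by rewrite of_realN scalerN scaleNr opprK.
Qed.

Lemma convex_bodies_dilate {K c} : 0 < c -> convex_bodies K ->
  convex_bodies (dilate c K).
Proof.
move=> c0 bK; have [_ cK vK sK] := bK.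
have c0F : of_real s c != 0 :> F by rewrite gt_eqF// of_real_gt0.
split.
- by exists 0, 0; [exact: convex_bodies0|rewrite scaler0].
(* Closedness is stable under preimage by a continuous map. *)
- have -> : dilate c K = ( *:%R (of_real s c)^-1) @^-1` K.
    apply/seteqP; split => [_ [u Ku <-]|u Ku] /=.
      by rewrite scalerA mulVf// scale1r.
    by exists ((of_real s c)^-1 *: u) => //; rewrite scalerA divff// scale1r.
  by apply: closed_comp => // u _; exact: scaler_continuous.
- move=> x y l /set_mem[x' Kx <-] /set_mem[y' Ky <-]; apply/mem_set.
  exists ((l%:num : F) *: x' + (1 - l%:num) *: y').
    by apply: set_mem; exact: vK x' y' l (mem_set Kx) (mem_set Ky).
  rewrite scalerDr !scalerA (mulrC (of_real s c)) (mulrC _ (1 - _)) -!scalerA.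
  by [].
- move=> _ z [u Ku <-] z1; exists (z *: u); first exact: sK.
  by rewrite !scalerA mulrC.
Qed.

Lemma convex_bodies_smallest (G : set V) :
  convex_bodies (smallest convex_bodies G).
Proof.
split.
- by exists 0 => L [bL _]; exact: convex_bodies0.
- by apply: closed_bigI => L [[]].
- move=> x y l /set_mem sx /set_mem sy; apply/mem_set => L [bL GL].
  have [_ _ cL _] := bL; apply: set_mem.
  by apply: cL; apply: mem_set; [exact: sx|exact: sy].
- by move=> u z su z1 L [bL GL]; have [_ _ _ sL] := bL; apply: sL => //; exact: su.
Qed.

End realification.

(** * Measure of cubes and nestedness of dyadic grids *)

Section boxes.
Context {R : realType}.

Definition borel_box {d} (bl br : bool) (a : d.-tuple R) (l : R) :
    set (d.-tuple (measurableTypeR R)) :=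
  [set x | forall i : 'I_d,
    tnth x i \in Interval (BSide bl (tnth a i)) (BSide br (tnth a i + l))].

Lemma measurable_borel_box d bl br (a : d.-tuple R) (l : R) :
  measurable (borel_box bl br a l).
Proof.
have -> : borel_box bl br a l = \bigcap_(i in [set: 'I_d])
    ((@tnth d (measurableTypeR R))^~ i @^-1`
      [set` Interval (BSide bl (tnth a i)) (BSide br (tnth a i + l))]).
  by apply/seteqP; split => x h i; [move=> _|]; exact: h.
apply: fin_bigcap_measurable => // i _; rewrite -[X in measurable X]setTI.
by apply: measurable_tnth.
Qed.

Lemma borel_lebesgue_box d bl br (a : d.-tuple R) (l : R) : 0 < l ->
  borel_lebesgue R d (borel_box bl br a l) = (l ^+ d)%:E.
Proof.
move=> l0; elim: d a => [|d ih] a.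
  by rewrite /= diracE mem_set// => -[].
case/tupleP: a => h t.
rewrite /= /cons_measure /pushforward.
rewrite (_ : _ @^-1` _ =
  [set` Interval (BSide bl h) (BSide br (h + l))] `*` borel_box bl br t l).
  rewrite product_measure1E//= ?ih.
  - by rewrite lebesgue_measure_itv/= lte_fin ltrDl l0 -EFinD addrAC subrr add0r
      -EFinM exprS.
  - exact: measurable_borel_box.
apply/seteqP; split => [[x y] /= hxy|[x y] /= [hx hy] i].
  split; first by have := hxy ord0; rewrite !tnth0.
  by move=> i; have := hxy (lift ord0 i); rewrite !tnthS.
by case: (unliftP ord0 i) => [j|] ->; rewrite ?tnthS ?tnth0//; exact: hy.
Qed.

Lemma measurable_box d bl br (a : d.-tuple R) (l : R) : measurable (box bl br a l).
Proof.
apply: sub_caratheodory; apply: sub_sigma_algebra; exact: measurable_borel_box.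
Qed.

Lemma lebesgue_box d bl br (a : d.-tuple R) (l : R) : 0 < l ->
  lebesgue R d (box bl br a l) = (l ^+ d)%:E.
Proof.
move=> l0; rewrite -(borel_lebesgue_box d bl br a l l0).
by apply: measurable_mu_extE; exact: measurable_borel_box.
Qed.
End boxes.

Definition nested_family {T} (B : set (set T)) :=
  forall P Q, B P -> B Q -> [\/ P `<=` Q, Q `<=` P | P `&` Q = set0].

Section cubes.
Context {R : realType} {d : nat}.
Implicit Types (P Q : set (euclidean R d)) (D : set (set (euclidean R d))).

Lemma measurable_cube Q : cube Q -> measurable Q.
Proof. by move=> [bl [br [a [l [_ ->]]]]]; exact: measurable_box. Qed.

Lemma cube_lebesgue_gt0 Q : cube Q -> 0 < fine (lebesgue R d Q).
Proof.
by move=> [bl [br [a [l [l0 ->]]]]]; rewrite lebesgue_box//= exprn_gt0.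
Qed.

Lemma cube_lebesgue_lty Q : cube Q -> (lebesgue R d Q < +oo)%E.
Proof. by move=> [bl [br [a [l [l0 ->]]]]]; rewrite lebesgue_box// ltry. Qed.

Lemma lebesgue_sub_cube_fin_num Q U : cube Q -> measurable U -> U `<=` Q ->
  lebesgue R d U \is a fin_num.
Proof.
move=> cQ mU UQ; rewrite ge0_fin_numE//.
apply: le_lt_trans (cube_lebesgue_lty _ cQ).
by apply: le_measure => //; rewrite inE//; exact: measurable_cube.
Qed.

Lemma dyadic_cube D Q : dyadic_grid D -> D Q -> cube Q.
Proof.
move=> [G -> HG] [k _ GQ]; have [_ hQ _] := HG k.
by have [b [a ->]] := hQ _ GQ; exists b, b, a, (2 ^ k); rewrite exprz_gt0.
Qed.

Lemma dyadic_nested D : dyadic_grid D -> nested_family D.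
Proof.
move=> [G -> HG] P Q [j _ GP] [k _ GQ].
(* A cube meeting a cube of m generations above lies in it: descend one
   generation inside the larger cube. *)
have desc (m : nat) : forall i P' Q', G (i - m%:Z) P' -> G i Q' ->
    P' `&` Q' !=set0 -> P' `<=` Q'.
  elim: m => [|m ih] i P' Q' GP' GQ' [x [Px Qx]].
    rewrite subr0 in GP'; have [[_ tG _] _ _] := HG i.
    by rewrite (tG _ _ GP' GQ')//; exists x.
  have [_ _ ch] := HG i; have [C [CG _ defQ]] := ch _ GQ'.
  move: Qx; rewrite defQ => -[Q1 CQ1 Q1x].
  apply: (@subset_trans _ Q1); last exact: bigcup_sup.
  apply: ih (CG _ CQ1) _; last by exists x.
  by rewrite (_ : i - 1 - m%:Z = i - m.+1%:Z)//; lia.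
have [->|/set0P PQ] := eqVneq (P `&` Q) set0; first by constructor 3.
have [jk|/ltW kj] := leP j k.
  constructor 1; apply: (desc `|k - j|%N k) => //.
  by rewrite (_ : k - _ = j)//; lia.
constructor 2; apply: (desc `|j - k|%N j) => //; last by rewrite setIC.
by rewrite (_ : j - _ = k)//; lia.
Qed.

End cubes.

(** * Integrals of selections *)

Lemma measurable_fun_piecewise {d1 d2} {T1 : measurableType d1}
    {T2 : measurableType d2} {f g : T1 -> T2} {U : set T1} :
  measurable U -> measurable_fun setT f -> measurable_fun setT g ->
  measurable_fun setT (patch g U f).
Proof.
move=> mU; apply: measurable_fun_ifT; apply: (measurable_fun_bool true).
by rewrite setTI (_ : _ @^-1` _ = U)//; apply/seteqP; split => x;
  [exact: set_mem|exact: mem_set].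
Qed.

Lemma dominated_integrable {d} {T : measurableType d} {R : realType}
    {mu : {measure set T -> \bar R}} {g h : T -> R} {B : R} :
  measurable_fun setT g -> measurable_fun setT h -> (forall x, `|g x| <= h x) ->
  (\int[mu]_x (h x)%:E <= B%:E)%E ->
  mu.-integrable setT (EFin \o g) /\
  forall Q, measurable Q -> `|\int[mu]_(x in Q) g x| <= B.
Proof.
move=> mg mh gh hB.
have int_g : (\int[mu]_x `|(g x)%:E| <= B%:E)%E.
  apply: le_trans hB; apply: ge0_le_integral => //.
  - by apply: measurableT_comp => //; exact/measurable_EFinP.
  - exact/measurable_EFinP.
  - by move=> x _; rewrite lee_fin.
have ig : mu.-integrable setT (EFin \o g).
  apply/integrableP; split; first exact/measurable_EFinP.
  exact: le_lt_trans int_g (ltry B).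
split=> // Q mQ; rewrite -lee_fin EFin_normr_Rintegral//; last first.
  exact: integrableS ig.
apply: le_trans int_g; apply: le_trans (le_abse_integral _ _ _) _ => //.
  by apply: measurable_funTS; exact/measurable_EFinP.
apply: ge0_subset_integral => //.
by apply: measurableT_comp => //; exact/measurable_EFinP.
Qed.

Section selections.
Context {R : realType} {s : scalar_kind} {d n : nat}.
Local Notation F := (scalar_field R s).
Local Notation X := (euclidean R d).
Local Notation V := 'rV[F]_n.
Local Notation mu := (lebesgue R d).
Implicit Types (f : X -> V) (A : X -> set V) (Q U : set X).

Lemma continuous_scalar_re : continuous (@scalar_re R s : F -> R).
Proof.
move=> z; apply: (proj2 (@cvgrPdist_lt R R _ (nbhs z) _ _ _)) => e e0.
have := nbhsx_ballx z _ (of_real_gt0 _ e0); apply: filterS => w.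
rewrite -ball_normE /= => /normr_scalar_re_lt.
by rewrite scalar_reD -mulN1r -of_real1 -of_realN scalar_re_scale mulN1r.
Qed.

Lemma continuous_scalar_im : continuous (@scalar_im R s : F -> R).
Proof.
move=> z; apply: (proj2 (@cvgrPdist_lt R R _ (nbhs z) _ _ _)) => e e0.
have := nbhsx_ballx z _ (of_real_gt0 _ e0); apply: filterS => w.
rewrite -ball_normE /= => /(normr_scalar_im_lt _ _ e0).
by rewrite scalar_imD -mulN1r -of_real1 -of_realN scalar_im_scale mulN1r.
Qed.

Lemma continuous_realify k : continuous (fun u : V => realify u 0 k).
Proof.
case: (split_ordP k) => j -> u.
- rewrite (_ : (fun u => _) = @scalar_re R s \o (fun u : V => u 0 j)); last first.
    by apply/funext => v /=; rewrite row_mxEl mxE.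
  apply: continuous_comp; first exact: coord_continuous.
  exact: continuous_scalar_re.
- rewrite (_ : (fun u => _) = @scalar_im R s \o (fun u : V => u 0 j)); last first.
    by apply/funext => v /=; rewrite row_mxEr mxE.
  apply: continuous_comp; first exact: coord_continuous.
  exact: continuous_scalar_im.
Qed.

Lemma measurable_realify f k :
  measurable_fun [set: X] (f : X -> @borel_vector R s n) ->
  measurable_fun [set: X] (fun x => realify (f x) 0 k).
Proof.
move=> mf; apply: (measurability _ (RGenOInfty.measurableE R)).
move=> _ [_ [a ->] <-]; rewrite setTI.
have -> : (fun x => realify (f x) 0 k) @^-1` `]a, +oo[ =
  [set: X] `&` f @^-1` ((fun u : V => realify u 0 k) @^-1` `]a, +oo[).
  by rewrite setTI.
apply: mf => //; apply: sub_sigma_algebra.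
by apply: open_comp => // u _; exact: continuous_realify.
Qed.

Lemma measurable_enorm f :
  measurable_fun [set: X] (f : X -> @borel_vector R s n) ->
  measurable_fun [set: X] (fun x => enorm (f x)).
Proof.
move=> mf.
rewrite (_ : (fun x => _) = Num.sqrt \o (fun x => \sum_j
    (realify (f x) 0 (lshift n j) ^+ 2 + realify (f x) 0 (rshift n j) ^+ 2))).
  apply: measurableT_comp.
    by apply: continuous_measurable_fun; exact: sqrt_continuous.
  apply: measurable_sum => j.
  by apply: measurable_funD; apply: measurable_funX; exact: measurable_realify.
apply/funext => x /=; congr Num.sqrt; apply: eq_bigr => j _.
by rewrite row_mxEl row_mxEr !mxE.
Qed.

Lemma realify_integral_vector Q f k :
  realify (integral_vector Q f) 0 k = \int[mu]_(x in Q) realify (f x) 0 k.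
Proof.
case: (split_ordP k) => j ->.
- rewrite row_mxEl !mxE scalar_re_mk.
  by apply: eq_Rintegral => x _; rewrite row_mxEl mxE.
- rewrite row_mxEr !mxE scalar_im_mk.
    by apply: eq_Rintegral => x _; rewrite row_mxEr mxE.
  move=> sR; rewrite /Rintegral integral0_eq// => x _.
  by rewrite scalar_im_real.
Qed.

Lemma dominated_selection A B f k : selections A f ->
  (\int[mu]_x (enorm (f x))%:E <= B%:E)%E ->
  mu.-integrable [set: X] (EFin \o fun x => realify (f x) 0 k) /\
  forall Q, measurable Q -> `|realify (integral_vector Q f) 0 k| <= B.
Proof.
move=> [mf _] fB; have [ig gB] := dominated_integrable (measurable_realify _ k mf)
  (measurable_enorm _ mf) (fun x => normr_realify_le_enorm (f x) k) fB.
by split=> // Q mQ; rewrite realify_integral_vector; exact: gB.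
Qed.

(** Convex bodies contain 0, so a selection over a smaller set extends by zero to
    a selection over a larger one. *)
Lemma selections_extend A U Q f : measurable U -> U `<=` Q -> (forall x, A x 0) ->
  selections (cutoff U A) f ->
  selections (cutoff Q A) (patch (fun=> 0) U f).
Proof.
move=> mU UQ A0 [mf sf]; split.
  have m0 : measurable_fun [set: X] ((fun=> 0) : X -> @borel_vector R s n).
    exact: measurable_cst.
  exact: (@measurable_fun_piecewise _ _ X (@borel_vector R s n) f (fun=> 0) U mU mf m0).
apply: filterS sf => x; rewrite /cutoff /patch.
case: (boolP (x \in U)) => [/set_mem Ux|_ _].
  by rewrite (mem_set (UQ _ Ux)).
by case: ifP.
Qed.

Lemma integral_vector_extend U Q f : U `<=` Q ->
  integral_vector Q (patch (fun=> 0) U f) = integral_vector U f.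
Proof.
move=> UQ; apply: realify_inj; apply/rowP => k.
rewrite !realify_integral_vector -{2}(setIidr UQ) Rintegral_mkcondr.
apply: eq_Rintegral => x _; rewrite /patch; case: ifP => // _.
by rewrite realify0 mxE.
Qed.

(** The source of all lower bounds on the average over Q: integrals over subsets
    of Q, divided by |Q|, belong to it. *)
Lemma average_extend A U Q f : measurable U -> U `<=` Q -> (forall x, A x 0) ->
  selections (cutoff U A) f ->
  average A Q (of_real s (fine (mu Q))^-1 *: integral_vector U f).
Proof.
move=> mU UQ A0 sf; exists (patch (fun=> 0) U f).
  exact: selections_extend.
by rewrite integral_vector_extend.
Qed.

Lemma integrable_selection_sub A U Q f k :
  measurable U -> U `<=` Q -> (forall x, A x 0) -> L1_bodies (cutoff Q A) ->
  selections (cutoff U A) f ->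
  mu.-integrable U (EFin \o fun x => realify (f x) 0 k).
Proof.
move=> mU UQ A0 LQ /(selections_extend _ _ _ _ mU UQ A0) sf.
have [_ [B LB]] := LQ; have [ig _] := dominated_selection _ _ _ k sf (LB _ sf).
move: ig => /(integrableS measurableT mU (@subsetT _ _)); apply: eq_integrable => //.
by move=> x xU /=; rewrite /patch xU.
Qed.

End selections.

(** * Gluing selections over nested cubes *)

(** Both inductions below remove at each step an inclusion-maximal set, together
    with an arbitrary part of the family. *)
Lemma finite_maximal_ind (T : Type) (P : set (set T) -> Prop) :
  P set0 ->
  (forall B Q, finite_set B -> B Q ->
     (forall Q', B Q' -> Q `<=` Q' -> Q' `<=` Q) ->
     (forall B', B' `<=` B -> ~ B' Q -> P B') -> P B) ->
  forall B, finite_set B -> P B.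
Proof.
move=> P0 step B /finite_seqP[r ->].
elim: {r}(size r) {-2}r (leqnn (size r)) => [|N ih] r sr.
  have -> : r = [::] by case: r sr.
  by rewrite set_nil.
have [-> |r0] := eqVneq r [::]; first by rewrite set_nil.
have [Q rQ Qmax] : exists2 Q, Q \in r &
    forall Q', Q' \in r -> Q `<=` Q' -> Q' `<=` Q.
  elim: r r0 {sr ih} => // a [|b r] ihr _.
    by exists a; [rewrite mem_head|move=> Q'; rewrite mem_seq1 => /eqP ->].
  have [//|Q rQ Qmax] := ihr.
  have [Qa|nQa] := pselect (Q `<=` a).
    exists a; first by rewrite mem_head.
    move=> Q'; rewrite in_cons => /orP[/eqP -> //|rQ'] aQ'.
    exact: subset_trans (Qmax _ rQ' (subset_trans Qa aQ')) Qa.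
  exists Q; first by rewrite in_cons rQ orbT.
  by move=> Q'; rewrite in_cons => /orP[/eqP -> //|rQ']; exact: Qmax.
apply: (step _ Q) => //= B' B'r nB'Q.
have -> : B' = [set` [seq Q' <- r | Q' \in B']].
  apply/seteqP; split => Q' /=; rewrite mem_filter.
    by move=> B'Q'; rewrite mem_set//; exact: B'r.
  by move=> /andP[/set_mem].
apply: ih; rewrite -ltnS (leq_trans _ sr)// size_filter.
rewrite -(count_predC (fun Q' => Q' \in B') r) -addn1 leq_add2l -has_count.
by apply/hasP; exists Q => //=; apply/negP => /set_mem.
Qed.

Section gluing.
Context {R : realType} {s : scalar_kind} {d n : nat}.
Local Notation F := (scalar_field R s).
Local Notation X := (euclidean R d).
Local Notation V := 'rV[F]_n.
Local Notation mu := (lebesgue R d).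
Implicit Types (f : X -> V) (A : X -> set V) (Q U : set X) (B : set (set X)).

Lemma selections_cutoff0 A : selections (cutoff set0 A) (fun=> 0).
Proof.
split; last by apply: aeW => x; rewrite /cutoff /patch in_set0.
exact: (@measurable_cst _ _ X (@borel_vector R s n)).
Qed.

Lemma selections_glue A U U' f f' : measurable U ->
  selections (cutoff U A) f -> selections (cutoff U' A) f' ->
  selections (cutoff (U `|` U') A) (patch f' U f).
Proof.
move=> mU [mf sf] [mf' sf']; split.
  exact: (@measurable_fun_piecewise _ _ X (@borel_vector R s n)).
apply: filterS2 sf sf' => x; rewrite /cutoff /patch in_setU.
by case: (x \in U).
Qed.

Lemma integral_vector_glue U U' f f' : measurable U -> measurable U' ->
  [disjoint U & U'] ->
  (forall k, mu.-integrable (U `|` U')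
     (EFin \o fun x => realify (patch f' U f x) 0 k)) ->
  integral_vector (U `|` U') (patch f' U f) =
  integral_vector U f + integral_vector U' f'.
Proof.
move=> mU mU' UU' ig; apply: realify_inj; rewrite realifyD.
apply/rowP => k; rewrite [RHS]mxE !realify_integral_vector.
rewrite (Rintegral_setU mU mU' (ig k) UU'); congr (_ + _).
  by apply: eq_Rintegral => x xU; rewrite /patch xU.
apply: eq_Rintegral => x xU'; rewrite /patch ifF//; apply/negP => xU.
by have /disj_setPS/(_ x) := UU'; apply; split; exact: set_mem.
Qed.

(** Remove a maximal cube Q of the family with all its subcubes. The remaining
    cubes are disjoint from Q by nestedness, so the selection on Q and the one
    obtained for the remaining cubes live on disjoint sets and their integrals
    add up. *)
Lemma glued_selection A Q0 (phi : V -> R) (c : R) B :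
  {morph phi : u v / u + v} -> (forall x, A x 0) ->
  cube Q0 -> L1_bodies (cutoff Q0 A) ->
  finite_set B ->
  (forall Q, B Q -> cube Q /\ Q `<=` Q0) ->
  nested_family B ->
  (forall Q, B Q -> exists2 f, selections (cutoff Q A) f &
     c * fine (mu Q) <= phi (integral_vector Q f)) ->
  let U := \bigcup_(Q in B) Q in
  exists2 f, selections (cutoff U A) f & c * fine (mu U) <= phi (integral_vector U f).
Proof.
move=> phiD A0 cQ0 LQ0 finB.
have phi0 : phi 0 = 0 by have := phiD 0 0; rewrite addr0; lra.
move: B finB; apply: finite_maximal_ind => [_ _ _ /=|B Q finB BQ Qmax ih cB nB fB U].
  rewrite bigcup_set0; exists (fun=> 0); first exact: selections_cutoff0.
  rewrite measure0 mulr0 (_ : integral_vector _ _ = 0) ?phi0//.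
  apply: realify_inj; apply/rowP => k; rewrite realify_integral_vector.
  by rewrite Rintegral_set0 realify0 mxE.
pose B' := [set Q' | B Q' /\ ~ Q' `<=` Q].
have B'B : B' `<=` B by move=> ? [].
have nB'Q : ~ B' Q by move=> [_]; apply.
have [f' sf' hf'] := ih B' B'B nB'Q (fun P BP => cB P (B'B _ BP))
  (fun P P' BP BP' => nB _ _ (B'B _ BP) (B'B _ BP'))
  (fun P BP => fB P (B'B _ BP)).
set U' := \bigcup_(Q in B') Q in sf' hf'.
have [f sf hf] := fB _ BQ; have [/measurable_cube mQ QQ0] := cB _ BQ.
have mB Q' : B Q' -> measurable Q' by move=> /cB[/measurable_cube].
have mU' : measurable U'.
  apply: fin_bigcup_measurable => [|Q' /B'B /mB//].
  exact: sub_finite_set finB.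
have UE : U = Q `|` U'.
  apply/seteqP; split => x; last first.
    by case=> [Qx|[Q' [BQ' _] Q'x]]; [exists Q|exists Q'].
  move=> [Q' BQ' Q'x]; have [sQ|nsQ] := pselect (Q' `<=` Q); first by left; exact: sQ.
  by right; exists Q'.
have dQU' : [disjoint Q & U'].
  apply/disj_setPS => x [Qx [Q' [BQ' nQ'Q] Q'x]].
  have [QQ'|//|QQ'0] := nB _ _ BQ BQ'; first by apply: nQ'Q; exact: Qmax.
  by have : (Q `&` Q') x by []; rewrite QQ'0.
have UQ0 : U `<=` Q0 by move=> x [Q' /cB[_ sQ'] /sQ'].
have sg : selections (cutoff U A) (patch f' Q f).
  by rewrite UE; apply: selections_glue.
exists (patch f' Q f) => //.
have mU : measurable U by rewrite UE; apply: measurableU.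
rewrite UE integral_vector_glue//; last first.
  by move=> k; rewrite -UE; exact: (integrable_selection_sub A U Q0).
rewrite phiD measureU//; last exact/disj_set2P.
rewrite fineD ?mulrDr ?lerD//; apply: (lebesgue_sub_cube_fin_num Q0) => //.
by move=> x U'x; apply: UQ0; rewrite UE; right.
Qed.

End gluing.

(** * Stopping cubes and sparse domination *)

Section stopping.
Context {R : realType} {s : scalar_kind} {d n : nat}.
Local Notation F := (scalar_field R s).
Local Notation X := (euclidean R d).
Local Notation V := 'rV[F]_n.
Local Notation mu := (lebesgue R d).
Implicit Types (f : X -> V) (A : X -> set V) (Q U : set X) (B : set (set X)).

Definition average_hull A Q : set V := smallest convex_bodies (average A Q).

Lemma average_hull_convex A Q : convex_bodies (average_hull A Q).
Proof. exact: convex_bodies_smallest. Qed.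

(** The rows of W are points of the average over Q and L computes coordinates
    with respect to them, as provided by an approximate Auerbach basis. *)
Lemma small_coordinates_dilate A Q m (W : 'M[R]_(m, n + n)) (w : 'I_m -> V)
    (L : 'M[R]_(n + n, m)) (c C : R) (u : V) :
  (forall i, average A Q (w i)) -> (forall i, realify (w i) = row i W) ->
  realify u = realify u *m L *m W ->
  (forall i, `|(realify u *m L) 0 i| <= c) -> m%:R * c <= C ->
  dilate C (average_hull A Q) u.
Proof.
move=> Aw wE uE uc mc.
have -> : u = \sum_i of_real s ((realify u *m L) 0 i) *: w i.
  apply: realify_inj; rewrite realify_lincomb [LHS]uE [LHS]mulmx_sum_row.
  by apply: eq_bigr => i _; rewrite wE.
apply: dilate_lincomb; first exact: average_hull_convex.
  by move=> i; apply: sub_gen_smallest.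
apply: le_trans mc; apply: (@le_trans _ _ (\sum_(i < m) c)); first exact: ler_sum.
by rewrite sumr_const card_ord mulr_natl.
Qed.

(** The weak-type estimate for one real functional. The glued selection, divided
    by |Q0|, gives a point of the average over Q0 at which phi is at least
    c |U| / |Q0|, U being the union of the family. *)
Lemma weak_type_estimate A Q0 B (phi : V -> R) (c : R) : 0 < c ->
  {morph phi : u v / u + v} -> (forall a u, phi (of_real s a *: u) = a * phi u) ->
  (forall x, A x 0) -> cube Q0 -> L1_bodies (cutoff Q0 A) ->
  (forall v, average A Q0 v -> `|phi v| <= 2) ->
  finite_set B ->
  (forall Q, B Q -> cube Q /\ Q `<=` Q0) ->
  nested_family B ->
  (forall Q, B Q -> exists2 u, average A Q u & c <= phi u) ->
  (mu (\bigcup_(Q in B) Q) <= (2 / c)%:E * mu Q0)%E.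
Proof.
move=> c0 phiD phiZ A0 cQ0 LQ0 phi2 finB cB nB fB.
have mU : measurable (\bigcup_(Q in B) Q).
  by apply: fin_bigcup_measurable => // Q /cB[/measurable_cube].
have UQ0 : \bigcup_(Q in B) Q `<=` Q0 by move=> x [Q /cB[_ sQ] /sQ].
have fB' Q : B Q -> exists2 f, selections (cutoff Q A) f &
    c * fine (mu Q) <= phi (integral_vector Q f).
  move=> BQ; have [_ [f sf <-] cphi] := fB _ BQ; exists f => //.
  have Q_gt0 := cube_lebesgue_gt0 _ (cB _ BQ).1.
  by move: cphi; rewrite phiZ mulrC ler_pdivlMr.
have [f sf hf] := glued_selection _ _ _ _ _ phiD A0 cQ0 LQ0 finB cB nB fB'.
have Q0_gt0 := cube_lebesgue_gt0 _ cQ0.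
have := phi2 _ (average_extend _ _ _ _ mU UQ0 A0 sf).
move=> /(le_trans (ler_norm _)); rewrite phiZ mulrC ler_pdivrMr// => hphi.
rewrite -(fineK (lebesgue_sub_cube_fin_num _ _ cQ0 mU UQ0)).
have mQ0 := measurable_cube _ cQ0.
rewrite -(fineK (lebesgue_sub_cube_fin_num _ _ cQ0 mQ0 (@subset_refl _ _))).
rewrite -EFinM lee_fin mulrAC ler_pdivlMr// mulrC; exact: le_trans hf hphi.
Qed.

(** A bad subcube has a point with a signed coordinate above c = 16 n: otherwise
    the at most 2n coordinates of each of its points, in absolute value at most
    c, would put the average into the dilate by 2n c = 32 n^2. Each of the at most
    4n signed coordinates accounts for cubes of measure at most
    (2 / c) |Q0| = |Q0| / (8 n). *)
Lemma stopping_family A Q0 (FF : set (set X)) : (0 < n)%N ->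
  (forall x, A x 0) ->
  (forall Q, cube Q -> L1_bodies (cutoff Q A)) -> cube Q0 ->
  finite_set FF ->
  (forall Q, FF Q -> cube Q) ->
  nested_family FF ->
  (mu (\bigcup_(Q in [set Q | [/\ FF Q, Q `<=` Q0 &
        ~ average A Q `<=` dilate (32 * n%:R ^+ 2) (average_hull A Q0)]]) Q)
    <= 2^-1%:E * mu Q0)%E.
Proof.
move=> n0 A0 LA cQ0 finFF cF nF; set Bad := [set Q | _].
have LQ0 := LA _ cQ0.
pose rA := [set realify v | v in average A Q0].
have [B rAB] : exists B : R, forall u, rA u -> forall j, `|u 0 j| <= B.
  have [_ [B AB]] := LQ0; exists (`|(fine (mu Q0))^-1| * B).
  move=> _ [_ [f sf <-] <-] j; rewrite realifyZ mxE normrM ler_wpM2l//.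
  by apply: (dominated_selection _ _ _ j sf (AB _ sf)).2; exact: measurable_cube.
have [m [W [L [mn rAW rAE rA2]]]] := approximate_auerbach_basis _ _ _ _ rAB.
have /choice[w wP] : forall i, exists v, average A Q0 v /\ realify v = row i W.
  by move=> i; have [v Av vE] := rAW i; exists v.
pose c : R := 16 * n%:R.
have nR0 : 0 < n%:R :> R by rewrite ltr0n.
pose phi (ib : 'I_m * bool) (v : V) := (-1) ^+ ib.2 * (realify v *m L) 0 ib.1.
pose Bad_ ib := [set Q | [/\ FF Q, Q `<=` Q0 &
  exists2 u, average A Q u & c <= phi ib u]].
have subBad ib : Bad_ ib `<=` FF by move=> Q [].
have mBad_ ib : measurable (\bigcup_(Q in Bad_ ib) Q).
  apply: fin_bigcup_measurable => [|Q [/cF/measurable_cube//]].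
  exact: sub_finite_set finFF.
have BadE : \bigcup_(Q in Bad) Q `<=` \bigcup_ib \bigcup_(Q in Bad_ ib) Q.
  move=> x [Q [FQ QQ0 nQ] Qx].
  suff [ib [u Au cu]] : exists ib, exists2 u, average A Q u & c <= phi ib u.
    by exists ib => //; exists Q => //; split => //; exists u.
  apply: contrapT => /forallNP small; apply: nQ => u Au.
  apply: (small_coordinates_dilate _ _ m W w L c) => //.
  - by move=> i; exact: (wP i).1.
  - by move=> i; exact: (wP i).2.
  (* u is a multiple of a point of the average over Q0, hence in its span. *)
  - have [f sf uE] := Au.
    have mQ := measurable_cube _ (cF _ FQ).
    have := rAE _ (ex_intro2 _ _ _ (average_extend _ _ _ _ mQ QQ0 A0 sf) erefl).
    have Q0_gt0 := cube_lebesgue_gt0 _ cQ0.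
    rewrite realifyZ -!scalemxAl => /scalerI.
    have Q0_neq0 : (fine (mu Q0))^-1 != 0 by rewrite invr_neq0// gt_eqF.
    rewrite -uE realifyZ -!scalemxAl => h; congr (_ *: _); exact: h.
  - move=> i; rewrite ler_norml; apply/andP; split; rewrite leNgt; apply/negP => h.
      apply: (small (i, true)); exists u => //; rewrite /phi /= expr1 mulN1r.
      by rewrite lerNr ltW.
    by apply: (small (i, false)); exists u => //; rewrite /phi /= expr0 mul1r ltW.
  - rewrite /c; apply: (@le_trans _ _ ((n + n)%:R * (16 * n%:R))).
      by rewrite ler_wpM2r ?ler_nat// mulr_ge0.
    by rewrite natrD expr2; lra.
have small ib : (mu (\bigcup_(Q in Bad_ ib) Q) <= (2 / c)%:E * mu Q0)%E.
  apply: (weak_type_estimate A Q0 _ (phi ib)) => //.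
  - by rewrite /c mulr_gt0.
  - by move=> u v; rewrite /phi realifyD mulmxDl mxE mulrDr.
  - by move=> a u; rewrite /phi realifyZ -scalemxAl mxE mulrCA.
  - move=> v Av; rewrite /phi normrM normrX normrN1 expr1n mul1r.
    by apply: rA2; exists v.
  - exact: sub_finite_set finFF.
  - by move=> Q [FQ QQ0 _]; split => //; exact: cF.
  - by move=> P Q /subBad FP /subBad FQ; exact: nF.
  - by move=> Q [].
apply: (@le_trans _ _ (\sum_(ib \in [set: 'I_m * bool])
  mu (\bigcup_(Q in Bad_ ib) Q))%E).
  apply: content_sub_fsum => //; first exact: finite_finset.
  apply: fin_bigcup_measurable => [|Q [/cF/measurable_cube//]].
  by apply: sub_finite_set finFF => Q [].
rewrite (_ : [set: _] = [set` index_enum ('I_m * bool)%type]); last first.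
  by apply/seteqP; split => ib //= _; exact: mem_index_enum.
rewrite -fsbig_seq ?index_enum_uniq//.
apply: le_trans (lee_sum _ (fun ib _ => small ib)) _.
have mQ0 := measurable_cube _ cQ0.
have muQ0 := lebesgue_sub_cube_fin_num _ _ cQ0 mQ0 (@subset_refl _ _).
rewrite -(fineK muQ0) -!EFinM sumEFin lee_fin sumr_const card_prod card_ord card_bool.
rewrite -[leLHS]mulr_natl mulrA ler_wpM2r ?fine_ge0// mulrA ler_pdivrMr ?mulr_gt0//.
have : m%:R <= (n + n)%:R :> R by rewrite ler_nat.
by rewrite natrM natrD /c; lra.
Qed.

(** Select a maximal cube Q0 and recurse on the cubes that Q0 does not dominate.
    Those strictly inside Q0 are all bad for Q0, which gives sparseness at Q0. By
    maximality Q0 is not strictly inside another selected cube, so sparseness at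
    the cubes selected later is inherited. *)
Lemma sparse_domination A (FF : set (set X)) : (0 < n)%N ->
  (forall x, A x 0) ->
  (forall Q, cube Q -> L1_bodies (cutoff Q A)) ->
  finite_set FF ->
  (forall Q, FF Q -> cube Q) ->
  nested_family FF ->
  exists S : set (set X), [/\ S `<=` FF, sparse S &
    forall Q, FF Q -> exists Q0, [/\ S Q0, Q `<=` Q0 &
      average A Q `<=` dilate (32 * n%:R ^+ 2) (average_hull A Q0)]].
Proof.
move=> n0 A0 LA; move: FF; apply: finite_maximal_ind.
  by move=> _ _; exists set0; split.
move=> FF Q0 finFF FQ0 Q0max ih cF nF.
pose good Q := Q `<=` Q0 /\
  average A Q `<=` dilate (32 * n%:R ^+ 2) (average_hull A Q0).
pose FF' := [set Q | FF Q /\ ~ good Q].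
have FF'F : FF' `<=` FF by move=> Q [].
have goodQ0 : good Q0.
  split=> // u Au; apply: (@dilate_le _ _ _ _ 1) => //.
  - exact: average_hull_convex.
  - have : 1 <= n%:R :> R by rewrite ler1n.
    by move=> n1; rewrite -[leLHS]mulr1 ler_pM// ?exprn_ege1// ler1n.
  - by exists u; [exact: sub_gen_smallest|rewrite of_real1 scale1r].
have nQ0 : ~ FF' Q0 by move=> [_]; apply.
have [S' [S'F spS' domS']] := ih FF' FF'F nQ0 (fun Q FQ => cF Q (FF'F _ FQ))
  (fun P Q FP FQ => nF P Q (FF'F _ FP) (FF'F _ FQ)).
have SF : Q0 |` S' `<=` FF by move=> Q [->//|/S'F/FF'F].
have mUB (B : set (set X)) : B `<=` FF -> measurable (\bigcup_(Q in B) Q).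
  move=> BF; apply: fin_bigcup_measurable => [|Q /BF/cF/measurable_cube//].
  exact: sub_finite_set finFF.
exists (Q0 |` S'); split => //.
- move=> Q [->|S'Q].
    apply: le_trans (stopping_family A Q0 FF n0 A0 LA (cF _ FQ0) finFF cF nF).
    apply: le_measure; rewrite ?inE.
    + by apply: mUB => Q' [/SF].
    + by apply: mUB => Q' [].
    + move=> x [Q' [[->|S'Q'] [Q'Q0 nQ0Q']]]; first by case: nQ0Q'.
      move=> Q'x; exists Q' => //.
      have [FQ' nQ'] := S'F _ S'Q'.
      by split => // avQ'; apply: nQ'.
  have := spS' _ S'Q; congr (mu (\bigcup_(Q' in _) Q') <= _)%E.
  apply/seteqP; split => Q' [SQ' [Q'Q nQQ']]; split => //; first by right.
  case: SQ' => // Q'Q0; case: nQQ'; rewrite Q'Q0; apply: Q0max; last by rewrite -Q'Q0.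
  by apply: FF'F; exact: S'F.
- move=> Q FQ; have [gQ|nQ] := pselect (good Q).
    by exists Q0; case: gQ => ? ?; split => //; left.
  have [Q1 [S'Q1 QQ1 avQ]] := domS' Q (conj FQ nQ).
  by exists Q1; split => //; right.
Qed.

End stopping.

Theorem theoremC (R : realType) (n : nat) (hn : (0 < n)%N) :
  exists2 C : R, 0 < C &
    forall (s : scalar_kind) (d : nat), (0 < d)%N ->
    forall D FF : set (set (euclidean R d)),
      dyadic_grid D -> FF `<=` D -> finite_set FF ->
    forall F : euclidean R d -> set 'rV[scalar_field R s]_n,
      L0_bodies F ->
      (forall Q, cube Q -> L1_bodies (cutoff Q F)) ->
    exists S : set (set (euclidean R d)),
      [/\ S `<=` FF, sparse S &
          {ae lebesgue R d, forall x, maximal FF F x `<=` dilate C (maximal S F x)}].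
Proof.
exists (32 * n%:R ^+ 2); first by rewrite mulr_gt0// exprn_gt0// ltr0n.
move=> s d _ D FF dD FFD finFF F [bF _] LF.
have cF Q : FF Q -> cube Q by move=> /FFD; exact: dyadic_cube.
have nF : nested_family FF.
  by move=> P Q /FFD DP /FFD DQ; exact: (dyadic_nested D).
have F0 x : F x 0 by exact: convex_bodies0.
have [S [SFF spS domS]] := sparse_domination F FF hn F0 LF finFF cF nF.
exists S; split => //; apply: aeW => x.
have bS : convex_bodies (maximal S F x) by exact: convex_bodies_smallest.
have bCS : convex_bodies (dilate (32 * n%:R ^+ 2) (maximal S F x)).
  by apply: convex_bodies_dilate => //; rewrite mulr_gt0// exprn_gt0// ltr0n.
(* The dilate is itself a convex body, so it suffices to test generators. *)
apply: smallest_sub => // u [Q FQ]; rewrite /cutoff /patch.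
case: ifPn => [/set_mem Qx Au|_ ->]; last exact: convex_bodies0.
have [Q0 [SQ0 QQ0 /(_ _ Au)[v hv <-]]] := domS _ FQ.
exists v => //; move: v hv; apply: smallest_sub => // v Av.
apply: sub_gen_smallest; exists Q0 => //.
by rewrite /cutoff /patch (mem_set (QQ0 _ Qx)).
Qed.
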